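(* Let $a\in\mathbf{C}$. For every $\frac12$-derivation $D$ of the transposed Poisson algebra $\mathcal{W}(a,-1)$ there exist sequences $(\alpha_j)_{j\in\mathbf{Z}}$, $(\beta_j)_{j\in\mathbf{Z}}$ of complex numbers with finite support such that for all $n,m\in\mathbf{Z}$ $$D(L_n)=\sum_j\bigl(\alpha_jL_{j+n}+\beta_jI_{j+n}\bigr),\qquad D(I_m)=\sum_j\alpha_jI_{j+m}.$$
   Context: All algebras are over $\mathbf{C}$. For $a\in\mathbf{C}$, the transposed Poisson algebra $\mathcal{W}(a,-1)$ is the vector space with basis $\{L_n,I_m\mid n,m\in\mathbf{Z}\}$, with commutative associative product $L_n\cdot L_m=L_{n+m}$, $L_n\cdot I_m=I_{n+m}$, $I_n\cdot I_m=0$, and Lie bracket $[L_n,L_m]=(n-m)L_{n+m}$, $[L_n,I_m]=-(m+a-n)I_{n+m}$, $[I_n,I_m]=0$. A $\frac12$-derivation is a linear map $D$ satisfying $D(x\star y)=\frac12\bigl(D(x)\star y+x\star D(y)\bigr)$ for all $x,y$ and for both products $\star\in\{\cdot,[\ ,\ ]\}$. *)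

(* Defs.v *)
From HB Require Import structures.
From mathcomp Require Import all_boot all_order all_algebra.
From mathcomp Require Import finmap ring.
From mathcomp Require Export cardinality fsbigop classical_sets reals.
From mathcomp Require Export monalg complex.
From mathcomp Require Export all_boot all_order all_algebra.

Set Implicit Arguments.
Unset Strict Implicit.
Unset Printing Implicit Defensive.
Import GRing.Theory Num.Theory.
Local Open Scope ring_scope.

HB.mixin Record isTransposedPoisson (F : numFieldType) V of GRing.Lmodule F V :=
{
  tmul : V -> V -> V;
  tbracket : V -> V -> V;
  tmul_linearl : forall v, linear (tmul^~ v);
  tmulC : commutative tmul;
  tmulA : associative tmul;
  tbracket_linearl : forall v, linear (tbracket^~ v);
  tbracket_linearr : forall u, linear (tbracket u);
  tbracket_alt : forall u, tbracket u u = 0;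
  tbracket_jacobi : forall u v w,
    tbracket u (tbracket v w) + tbracket v (tbracket w u)
      + tbracket w (tbracket u v) = 0;
  tmul_bracket : forall u v w,
    2 *: tmul w (tbracket u v) = tbracket (tmul w u) v + tbracket u (tmul w v)
}.

#[short(type="transposedPoissonType")]
HB.structure Definition TransposedPoisson (F : numFieldType) :=
  { V of GRing.Lmodule F V & isTransposedPoisson F V }.

Definition half_derivation_for (F : numFieldType) (V : lmodType F)
    (star : V -> V -> V) (D : V -> V) : Prop :=
  forall u v, D (star u v) = 2^-1 *: (star (D u) v + star u (D v)).

Definition half_derivation (F : numFieldType) (V : transposedPoissonType F)
    (D : {linear V -> V}) : Prop :=
  half_derivation_for (@tmul F V) D /\ half_derivation_for (@tbracket F V) D.

Section LinearExtension.
Variables (F : numFieldType) (K : choiceType) (V : lmodType F).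

Definition lin_ext (g : K -> V) (u : {malg F[K]}) : V :=
  \sum_(x <- msupp u) u@_x *: g x.

Definition bilin_ext (f : K -> K -> V) (u v : {malg F[K]}) : V :=
  lin_ext (fun x => lin_ext (f x) v) u.

Lemma lin_extEw (g : K -> V) (u : {malg F[K]}) (d : {fset K}) :
  (msupp u `<=` d)%fset -> lin_ext g u = \sum_(x <- d) u@_x *: g x.
Proof.
move=> ud; rewrite /lin_ext; apply: big_fset_incl => // x _ xu.
by rewrite mcoeff_outdom // scale0r.
Qed.

Lemma lin_ext_linear (g : K -> V) : linear (lin_ext g).
Proof.
move=> c u v; pose d := (msupp u `|` msupp v)%fset.
have ud : (msupp u `<=` d)%fset by exact: fsubsetUl.
have vd : (msupp v `<=` d)%fset by exact: fsubsetUr.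
have cd : (msupp (c *: u + v) `<=` d)%fset.
  apply: fsubset_trans (msuppD_le _ _) _; apply: fsetSU; exact: msuppZ_le.
rewrite (lin_extEw g ud) (lin_extEw g vd) (lin_extEw g cd).
rewrite scaler_sumr -big_split /=; apply: eq_bigr => x _.
by rewrite mcoeffD mcoeffZ scalerDl scalerA.
Qed.

HB.instance Definition _ (g : K -> V) :=
  GRing.isLinear.Build F {malg F[K]} V *:%R (lin_ext g) (lin_ext_linear g).

Lemma lin_extU (g : K -> V) (x : K) : lin_ext g << x >> = g x.
Proof. by rewrite /lin_ext msuppU oner_eq0 big_seq_fset1 mcoeffUU scale1r. Qed.

Lemma bilin_ext_linearl (f : K -> K -> V) v : linear ((bilin_ext f)^~ v).
Proof. exact: lin_ext_linear. Qed.

Lemma bilin_ext_linearr (f : K -> K -> V) u : linear (bilin_ext f u).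
Proof.
move=> c v w; rewrite /bilin_ext /lin_ext scaler_sumr -big_split /=.
apply: eq_bigr => x _; rewrite -!/(lin_ext _ _) linearP scalerDr !scalerA.
by rewrite mulrC.
Qed.

Lemma bilin_extU (f : K -> K -> V) x y : bilin_ext f << x >> << y >> = f x y.
Proof. by rewrite /bilin_ext !lin_extU. Qed.

End LinearExtension.

Lemma malg_lin_ind (F : numFieldType) (K : choiceType)
    (P : {malg F[K]} -> Prop) :
  P 0 -> (forall c x u, P u -> P (c *: << x >> + u)) -> forall u, P u.
Proof.
move=> P0 PD u; rewrite (monalgE u); elim: (enum_fset _) => [|x s IH].
  by rewrite big_nil.
rewrite big_cons; have -> : << u@_x *g x >> = u@_x *: << x >> :> {malg F[K]}.
  by apply/malgP => k; rewrite mcoeffZ !mcoeffU; case: eqP; rewrite ?mulr1 ?mulr0.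
exact: PD.
Qed.

(* The axioms of [isTransposedPoisson] only need to be checked on L_n, I_m. *)
Section WalgAxioms.
Variables (F : numFieldType) (a : F) (V : lmodType F).
Variables (L I : int -> V) (mul br : V -> V -> V).

Hypothesis basis_ext : forall f g : V -> V, linear f -> linear g ->
  (forall n, f (L n) = g (L n)) -> (forall n, f (I n) = g (I n)) ->
  forall u, f u = g u.

Hypothesis mull : forall v, linear (mul^~ v).
Hypothesis mulr : forall u, linear (mul u).
Hypothesis brl : forall v, linear (br^~ v).
Hypothesis brr : forall u, linear (br u).

Hypothesis mulLL : forall n m, mul (L n) (L m) = L (n + m).
Hypothesis mulLI : forall n m, mul (L n) (I m) = I (n + m).
Hypothesis mulIL : forall m n, mul (I m) (L n) = I (n + m).
Hypothesis mulII : forall n m, mul (I n) (I m) = 0.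
Hypothesis brLL : forall n m, br (L n) (L m) = (n - m)%:~R *: L (n + m).
Hypothesis brLI : forall n m,
  br (L n) (I m) = - (m%:~R + a - n%:~R) *: I (n + m).
Hypothesis brIL : forall m n,
  br (I m) (L n) = (m%:~R + a - n%:~R) *: I (n + m).
Hypothesis brII : forall n m, br (I n) (I m) = 0.

Let lin0 (f : V -> V) : linear f -> f 0 = 0.
Proof.
by move=> lf; have := lf (-1) 0 0; rewrite scaler0 addr0 scaleN1r addNr.
Qed.

Let linZ (f : V -> V) c u : linear f -> f (c *: u) = c *: f u.
Proof. by move=> lf; rewrite -[c *: u]addr0 lf lin0 // addr0. Qed.

Let linD (f g : V -> V) : linear f -> linear g ->
  linear (fun u => f u + g u).
Proof. by move=> lf lg c u v; rewrite lf lg scalerDr addrACA. Qed.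

Let linS (f : V -> V) (k : F) : linear f -> linear (fun u => k *: f u).
Proof. by move=> lf c u v; rewrite lf scalerDr !scalerA mulrC. Qed.

Let lino (f g : V -> V) : linear f -> linear g ->
  linear (fun u => f (g u)).
Proof. by move=> lf lg c u v; rewrite lg lf. Qed.

Let linC0 : linear (fun _ : V => 0 : V).
Proof. by move=> c u v; rewrite scaler0 addr0. Qed.

Let mulE := (mulLL, mulLI, mulIL, mulII).
Let brE := (brLL, brLI, brIL, brII).
Let mull0 v : mul 0 v = 0. Proof. exact: lin0 (mull v). Qed.
Let mulr0 u : mul u 0 = 0. Proof. exact: lin0 (mulr u). Qed.
Let brl0 v : br 0 v = 0. Proof. exact: lin0 (brl v). Qed.
Let brr0 u : br u 0 = 0. Proof. exact: lin0 (brr u). Qed.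
Let mulZr u c v : mul u (c *: v) = c *: mul u v.
Proof. exact: linZ (mulr u). Qed.
Let brZr u c v : br u (c *: v) = c *: br u v.
Proof. exact: linZ (brr u). Qed.
Let simpE := (mull0, mulr0, brl0, brr0, mulZr, brZr, mulE, brE).

Let index_eq (f : int -> V) i j : i = j -> f i = f j.
Proof. by move=> ->. Qed.

Let scale_eq (f : int -> V) i j c d :
  i = j -> c = d -> c *: f i = d *: f j.
Proof. by move=> -> ->. Qed.

Let scale_eqD (f : int -> V) i j k c d e :
  i = k -> j = k -> e = c + d -> e *: f k = c *: f i + d *: f j.
Proof. by move=> -> -> ->; rewrite scalerDl. Qed.

Let scale_eq0 (f : int -> V) i j k c d e :
  i = k -> j = k -> c + d + e = 0 -> c *: f i + d *: f j + e *: f k = 0.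
Proof. by move=> -> -> cde; rewrite -!scalerDl cde scale0r. Qed.

Lemma basis_mulC : commutative mul.
Proof.
move=> u v; move: u; apply: (basis_ext (mull v) (mulr v)) => n.
all: move: v; apply: (basis_ext (mulr _) (mull _)) => m.
all: rewrite !simpE.
all: lazymatch goal with
     | |- L _ = L _ => apply: (index_eq L); ring
     | |- I _ = I _ => apply: (index_eq I); ring
     | _ => exact: erefl
     end.
Qed.

Lemma basis_mulA : associative mul.
Proof.
move=> u v w.
move: u; apply: (basis_ext (mull _) (lino (mull w) (mull v))) => n.
all: move: v; apply: (basis_ext (lino (mulr _) (mull w)) (lino (mull w) (mulr _))) => m.
all: move: w; apply: (basis_ext (lino (mulr _) (mulr _)) (mulr _)) => k.
all: rewrite !simpE.
all: lazymatch goal with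
     | |- L _ = L _ => apply: (index_eq L); ring
     | |- I _ = I _ => apply: (index_eq I); ring
     | _ => exact: erefl
     end.
Qed.

Lemma basis_bracketC u v : br u v = - br v u.
Proof.
rewrite -scaleN1r.
move: u; apply: (basis_ext (brl _) (linS (-1) (brr _))) => n.
all: move: v; apply: (basis_ext (brr _) (linS (-1) (brl _))) => m.
all: rewrite !simpE ?scaler0 ?scalerA.
all: lazymatch goal with
     | |- _ *: L _ = _ => apply: (scale_eq L); ring
     | |- _ *: I _ = _ => apply: (scale_eq I); ring
     | _ => exact: erefl
     end.
Qed.

Lemma basis_bracket_alt u : br u u = 0.
Proof.
have /eqP := basis_bracketC u u; rewrite -subr_eq0 opprK -mulr2n -scaler_nat.
by rewrite scaler_eq0 pnatr_eq0 /= => /eqP.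
Qed.

Lemma basis_bracket_jacobi u v w :
  br u (br v w) + br v (br w u)
    + br w (br u v) = 0.
Proof.
move: u; apply: (basis_ext (linD (linD (brl _) (lino (brr _) (brr _)))
  (lino (brr _) (brl _))) linC0) => n.
all: move: v; apply: (basis_ext (linD (linD (lino (brr _) (brl _)) (brl _))
  (lino (brr _) (brr _))) linC0) => m.
all: move: w; apply: (basis_ext (linD (linD (lino (brr _) (brr _))
  (lino (brr _) (brl _))) (brl _)) linC0) => k.
all: rewrite !simpE ?scaler0 ?addr0 ?scalerA.
all: lazymatch goal with
     | |- _ *: L _ + _ + _ = 0 => apply: (scale_eq0 L); ring
     | |- _ *: I _ + _ + _ = 0 => apply: (scale_eq0 I); ring
     | _ => exact: erefl
     end.
Qed.

Lemma basis_mul_bracket u v w :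
  2 *: mul w (br u v) = br (mul w u) v + br u (mul w v).
Proof.
move: u; apply: (basis_ext (linS 2 (lino (mulr _) (brl _)))
  (linD (lino (brl _) (mulr _)) (brl _))) => n.
all: move: v; apply: (basis_ext (linS 2 (lino (mulr _) (brr _)))
  (linD (brr _) (lino (brr _) (mulr _)))) => m.
all: move: w; apply: (basis_ext (linS 2 (mull _))
  (linD (lino (brl _) (mull _)) (lino (brr _) (mull _)))) => k.
all: rewrite !simpE ?scaler0 ?addr0 ?scalerA.
all: lazymatch goal with
     | |- _ = _ *: L _ + _ => apply: (scale_eqD L); ring
     | |- _ = _ *: I _ + _ => apply: (scale_eqD I); ring
     | _ => exact: erefl
     end.
Qed.

End WalgAxioms.

(* In the index type [int + int], [inl n] labels L_n and [inr m] labels I_m; it carries no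
   monoid structure, so [malg] is only a free module here. *)
Definition Walg (F : numFieldType) (a : F) := {malg F[(int + int)%type]}.

HB.instance Definition _ (F : numFieldType) (a : F) :=
  GRing.Lmodule.on (Walg a).

Section Walg.
Variables (F : numFieldType) (a : F).

Definition WL (n : int) : Walg a := << inl n >>.
Definition WI (m : int) : Walg a := << inr m >>.

Definition Wmul_basis (x y : int + int) : Walg a :=
  match x, y with
  | inl n, inl m => WL (n + m)
  | inl n, inr m => WI (n + m)
  | inr m, inl n => WI (n + m)
  | inr _, inr _ => 0
  end.

Definition Wbracket_basis (x y : int + int) : Walg a :=
  match x, y with
  | inl n, inl m => (n - m)%:~R *: WL (n + m)
  | inl n, inr m => - (m%:~R + a - n%:~R) *: WI (n + m)
  | inr m, inl n => (m%:~R + a - n%:~R) *: WI (n + m)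
  | inr _, inr _ => 0
  end.

Definition Wmul : Walg a -> Walg a -> Walg a := bilin_ext Wmul_basis.
Definition Wbracket : Walg a -> Walg a -> Walg a := bilin_ext Wbracket_basis.

Let Wmull v : linear (Wmul^~ v). Proof. exact: bilin_ext_linearl. Qed.
Let Wmulr u : linear (Wmul u). Proof. exact: bilin_ext_linearr. Qed.
Let Wbrl v : linear (Wbracket^~ v). Proof. exact: bilin_ext_linearl. Qed.
Let Wbrr u : linear (Wbracket u). Proof. exact: bilin_ext_linearr. Qed.

Lemma WmulLL n m : Wmul (WL n) (WL m) = WL (n + m).
Proof. exact: bilin_extU. Qed.
Lemma WmulLI n m : Wmul (WL n) (WI m) = WI (n + m).
Proof. exact: bilin_extU. Qed.
Lemma WmulIL m n : Wmul (WI m) (WL n) = WI (n + m).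
Proof. exact: bilin_extU. Qed.
Lemma WmulII n m : Wmul (WI n) (WI m) = 0.
Proof. exact: bilin_extU. Qed.

Lemma WbracketLL n m : Wbracket (WL n) (WL m) = (n - m)%:~R *: WL (n + m).
Proof. exact: bilin_extU. Qed.
Lemma WbracketLI n m :
  Wbracket (WL n) (WI m) = - (m%:~R + a - n%:~R) *: WI (n + m).
Proof. exact: bilin_extU. Qed.
Lemma WbracketIL m n :
  Wbracket (WI m) (WL n) = (m%:~R + a - n%:~R) *: WI (n + m).
Proof. exact: bilin_extU. Qed.
Lemma WbracketII n m : Wbracket (WI n) (WI m) = 0.
Proof. exact: bilin_extU. Qed.

Let Wbasis_ext (f g : Walg a -> Walg a) : linear f -> linear g ->
  (forall n, f (WL n) = g (WL n)) -> (forall n, f (WI n) = g (WI n)) ->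
  forall u, f u = g u.
Proof.
have lin0 (h : Walg a -> Walg a) : linear h -> h 0 = 0.
  by move=> lh; have := lh (-1) 0 0; rewrite scaler0 addr0 scaleN1r addNr.
move=> lf lg fgL fgI; apply: malg_lin_ind => [|c x u IH].
  by rewrite (lin0 _ lf) (lin0 _ lg).
rewrite lf lg IH; case: x => n.
  by rewrite -[<< inl n >>]/(WL n) fgL.
by rewrite -[<< inr n >>]/(WI n) fgI.
Qed.

HB.instance Definition _ := isTransposedPoisson.Build F (Walg a)
  Wmull
  (basis_mulC Wbasis_ext Wmull Wmulr WmulLL WmulLI WmulIL WmulII)
  (basis_mulA Wbasis_ext Wmull Wmulr WmulLL WmulLI WmulIL WmulII)
  Wbrl Wbrr
  (basis_bracket_alt Wbasis_ext Wbrl Wbrr WbracketLL WbracketLI WbracketIL WbracketII)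
  (basis_bracket_jacobi Wbasis_ext Wbrl Wbrr WbracketLL WbracketLI WbracketIL WbracketII)
  (basis_mul_bracket Wbasis_ext 
    Wmull Wmulr Wbrl Wbrr WmulLL WmulLI WmulIL WmulII WbracketLL WbracketLI WbracketIL WbracketII).

End Walg.

(* Main.v *)
Require Import Defs.
From mathcomp Require Import finmap.
Import GRing.Theory Num.Theory.
Local Open Scope classical_set_scope.
Local Open Scope ring_scope.

(** The commutative product alone forces the shape of [D], because it has the
    unit [L_0]. Putting [y = 1] in [D (x y) = (D x y + x D y) / 2] gives
    [D x = (D x + x D 1) / 2], so [D x = D 1 * x]: a half-derivation is the
    multiplication by [D 1] ([half_derivation_mul_unit]). Take
    [alpha j] and [beta j] to be the coordinates of [D L_0] along [L_j] and
    [I_j]; the two formulas are then the expansions of [D L_0 * L_n] and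
    [D L_0 * I_m] over the basis ([lin_ext_sum_fsbig]), where the [beta] part
    disappears from the second one since [I_j * I_m = 0]. *)

Lemma half_derivation_mul_unit (F : numFieldType) (V : transposedPoissonType F)
    (e : V) (D : V -> V) :
  right_id e (@tmul F V) -> half_derivation_for (@tmul F V) D ->
  forall x, D x = tmul (D e) x.
Proof.
move=> e1 hD x; have := hD x e; rewrite !e1 [tmul x _]tmulC => Dx.
have two0 : 2 != 0 :> F by rewrite pnatr_eq0.
have {Dx} : 2 *: D x = D x + tmul (D e) x by rewrite {1}Dx scalerA divff ?scale1r.
by rewrite scaler_nat mulr2n => /addrI.
Qed.

Lemma tmul_WL0 (F : numFieldType) (a : F) :
  right_id (WL a 0) (@tmul F (Walg a)).
Proof.
apply: malg_lin_ind => [|c x u IH].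
  by rewrite /tmul /= /Wmul /bilin_ext linear0.
rewrite tmul_linearl IH; congr (_ *: _ + _).
by case: x => n; [rewrite -/(WL a n) [LHS]WmulLL addr0
                 |rewrite -/(WI a n) [LHS]WmulIL add0r].
Qed.

Lemma finite_coords (F : numFieldType) (J K : choiceType) (u : {malg F[K]})
    (h : J -> K) :
  injective h -> finite_set [set j | u@_(h j) != 0].
Proof.
move=> hI; rewrite (_ : [set j | _] = h @^-1` [set` msupp u]).
  by apply: finite_preimage; [move=> x y _ _; apply: hI|exact: finite_fset].
by apply/seteqP; split=> j /=; rewrite mcoeff_neq0.
Qed.

(** All basis labels occurring in [u] have their index in a common finite set
    [d], so both sides are the sum of the same terms over [d], taken once for
    each of the two summands of the index type. *)
Lemma lin_ext_sum_fsbig (F : numFieldType) (V : lmodType F)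
    (g : int + int -> V) (u : {malg F[(int + int)%type]}) :
  lin_ext g u = \sum_(j \in [set: int])
    (u@_(inl j) *: g (inl j) + u@_(inr j) *: g (inr j)).
Proof.
pose idx (x : int + int) := match x with inl j => j | inr j => j end.
pose d := [fset idx x | x in msupp u]%fset.
have du x : x \in msupp u -> idx x \in d by move=> xu; apply/imfsetP; exists x.
have out x : idx x \notin d -> u@_x = 0.
  by move=> xd; apply: mcoeff_outdom; apply: contra xd; apply: du.
rewrite (fsbigTE d); last by move=> j jd; rewrite !out // !scale0r addr0.
pose s : seq (int + int) := [seq inl j | j <- d] ++ [seq inr j | j <- d].
have us : uniq s.
  rewrite cat_uniq !map_inj_uniq ?fset_uniq //=; try by move=> ? ? [].
  by rewrite andbT; apply/hasPn => _ /mapP[j _ ->]; apply/mapP => -[].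
have ud : (msupp u `<=` [fset x in s])%fset.
  apply/fsubsetP => -[] j /du /= jd; rewrite in_fset /s mem_cat; apply/orP.
    by left; apply: map_f.
  by right; apply: map_f.
rewrite (lin_extEw _ ud) big_split /=.
have -> : \sum_(x <- [fset x in s]%fset) u@_x *: g x = \sum_(x <- s) u@_x *: g x.
  by apply/perm_big/uniq_perm; rewrite ?fset_uniq // => x; rewrite in_fset.
by rewrite big_cat !big_map.
Qed.

Theorem theorem2p5 (R : realType) (a : R[i]) (D : {linear Walg a -> Walg a})
    (hD : half_derivation D) :
  exists alpha beta : int -> R[i],
    [/\ finite_set [set j | alpha j != 0],
        finite_set [set j | beta j != 0],
        forall n : int, D (WL a n) =
          \sum_(j \in [set: int]) (alpha j *: WL a (j + n) + beta j *: WI a (j + n))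
      & forall m : int, D (WI a m) =
          \sum_(j \in [set: int]) alpha j *: WI a (j + m)].
Proof.
have [/(half_derivation_mul_unit _ _ _ _ (tmul_WL0 _ a)) DE _] := hD.
pose u := D (WL a 0).
exists (fun j => u@_(inl j)), (fun j => u@_(inr j)); split => [||n|m].
- by apply: finite_coords => ? ? [].
- by apply: finite_coords => ? ? [].
- rewrite DE [LHS]lin_ext_sum_fsbig; apply: eq_fsbigr => j _.
  by rewrite !lin_extU /= [n + j]addrC.
- rewrite DE [LHS]lin_ext_sum_fsbig; apply: eq_fsbigr => j _.
  by rewrite !lin_extU /= scaler0 addr0.
Qed.
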